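(* Let $(X,d)$ be a metric space with $|X|\ge 2$, let $n$ be an integer with $2\le n\le |X|$, and let $T\colon X\to X$ be an $n$-point Kannan-type mapping. Then $T$ is continuous at each of its fixed points.
   Context: $|X|$ denotes the cardinality of $X$. For points $x_1,\dots,x_n$ of a metric space $(X,d)$ put $S(x_1,\dots,x_n)=\sum_{1\le i<j\le n} d(x_i,x_j)$. For an integer $n$ with $2\le n\le |X|$, a mapping $T\colon X\to X$ is called an $n$-point Kannan-type mapping if there exists $\lambda\in[0,\frac{n-1}{n})$ such that $S(Tx_1,\dots,Tx_n)\le \lambda\sum_{i=1}^n d(x_i,Tx_i)$ for all pairwise distinct points $x_1,\dots,x_n\in X$. *)

(* Defs.v *)
From mathcomp Require Import all_boot all_order all_algebra.
From mathcomp Require Import classical_sets reals topology.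

Set Implicit Arguments.
Unset Strict Implicit.
Unset Printing Implicit Defensive.

Import Order.TTheory GRing.Theory Num.Theory.
Local Open Scope ring_scope.

Definition sum_pairwise_dist (R : realType) (X : metricType R) (n : nat)
    (x : 'I_n -> X) : R :=
  \sum_(i < n) \sum_(j < n | (i < j)%N) mdist (x i) (x j).

(* A tuple of pairwise distinct points is an injective family. The range
   2 <= n <= |X| is not part of the predicate; it is to be assumed where the
   predicate is used. *)
Definition kannan_type (R : realType) (X : metricType R) (n : nat)
    (T : X -> X) : Prop :=
  exists lambda : R,
    0 <= lambda < (n%:R - 1) / n%:R /\
    forall x : 'I_n -> X, injective x ->
      sum_pairwise_dist (fun i => T (x i))
        <= lambda * \sum_(i < n) mdist (x i) (T (x i)).

(* Main.v *)
Require Import Defs.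
From mathcomp Require Import all_boot all_order all_algebra.
From mathcomp Require Import classical_sets cardinality reals topology.
From mathcomp Require Import boolp lra.

Set Implicit Arguments.
Unset Strict Implicit.
Unset Printing Implicit Defensive.

Local Open Scope classical_set_scope.
Local Open Scope card_scope.

(** At an isolated point continuity is trivial.  Otherwise a point [x <> p] near
    the fixed point [p] can be completed, by further points near [p], to [n]
    pairwise distinct points including [p].  Keeping only the pairs containing
    [p] in the Kannan inequality, and using [d(x, Tx) <= d(p, x) + d(p, Tx)],
    gives [(1 - lambda) * sum d(p, Tx_i) <= lambda * sum d(p, x_i)], whose
    right-hand side is arbitrarily small. *)

Section MetricSpace.
Import Order.TTheory GRing.Theory Num.Theory.
Local Open Scope ring_scope.
Variables (R : realType) (X : metricType R).

Definition isolated_point (p : X) :=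
  exists2 e : R, 0 < e & forall y, mdist p y < e -> y = p.

(** Induction on [s]: an entry [a] different from [p] is avoided by shrinking the radius to at most
    [mdist p a]; an entry equal to [p] is avoided because [y != p]. *)
Lemma non_isolated_avoid (p : X) (s : seq X) (e : R) :
  ~ isolated_point p -> 0 < e ->
  exists y, [/\ y != p, mdist p y < e & y \notin s].
Proof.
move=> Np; elim: s e => [|a s IHs] e e0.
  apply: contrapT => Ny; apply: Np; exists e => // y ye.
  by apply/eqP; apply: contrapT => /negP yp; apply: Ny; exists y.
have [->|ap] := eqVneq a p.
  have [y [yp ye ys]] := IHs e e0.
  by exists y; rewrite in_cons negb_or yp ys.
have m0 : 0 < Num.min e (mdist p a) by rewrite lt_min e0 mdist_gt0 eq_sym.
have [y [yp]] := IHs _ m0; rewrite lt_min => /andP[ye ya] ys.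
exists y; split=> //; rewrite in_cons negb_or ys andbT.
by apply: contraTneq ya => ->; rewrite ltxx.
Qed.

Lemma non_isolated_extend (p : X) (s : seq X) (e : R) (k : nat) :
  ~ isolated_point p -> 0 < e -> uniq (p :: s) ->
  {in s, forall y, mdist p y < e} ->
  exists t, [/\ uniq (p :: t ++ s), size t = k
    & {in t ++ s, forall y, mdist p y < e}].
Proof.
move=> Np e0 us se; elim: k => [|k [t [ut st te]]]; first by exists [::].
have [y [yp ye yts]] := non_isolated_avoid (t ++ s) Np e0.
exists (y :: t); split=> [||z] /=; last 2 first.
- by rewrite st.
- by rewrite in_cons => /predU1P[->//|]; apply: te.
move: ut => /= /andP[pts ->].
by rewrite in_cons negb_or eq_sym yp pts yts.
Qed.

(** With [p] at index 0 of the tuple, the pairs containing [p] are exactly those with [i = 0], and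
    [p] itself contributes nothing on the right since [T p = p]. *)
Lemma kannan_fixed_point_bound (T : X -> X) (m : nat) (lambda : R) (p : X)
    (s : seq X) :
  0 <= lambda ->
  (forall x : 'I_m.+1 -> X, injective x ->
    sum_pairwise_dist (fun i => T (x i))
      <= lambda * \sum_(i < m.+1) mdist (x i) (T (x i))) ->
  T p = p -> uniq (p :: s) -> size s = m ->
  (1 - lambda) * \sum_(y <- s) mdist p (T y)
    <= lambda * \sum_(y <- s) mdist p y.
Proof.
move=> l0 kT Tp us sm.
have inj : injective (fun i : 'I_m.+1 => nth p (p :: s) i).
  by move=> i j /eqP; rewrite nth_uniq ?ltn_ord//= ?sm// => /eqP/val_inj.
have sumE (F : X -> R) : \sum_(y <- s) F y = \sum_(i < m) F (nth p s i).
  by rewrite (big_nth p) big_mkord sm.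
have := kT _ inj; rewrite /sum_pairwise_dist big_ord_recl /=.
rewrite [X in _ <= _ * X]big_ord_recl /= Tp mdistxx add0r.
rewrite big_mkcond big_ord_recl /= add0r.
rewrite -(sumE (fun y => mdist p (T y))) -(sumE (fun y => mdist y (T y))).
set S := \sum_(i < m) _ => kS.
have S0 : 0 <= S by do 2 (apply: sumr_ge0 => ? _); apply: mdist_ge0.
have tri : \sum_(y <- s) mdist y (T y)
    <= \sum_(y <- s) mdist p y + \sum_(y <- s) mdist p (T y).
  rewrite -big_split /=; apply: ler_sum => y _.
  by rewrite (metric_sym p y) metric_triangle.
have := ler_wpM2l l0 tri; rewrite mulrDr mulrBl mul1r.
lra.
Qed.

End MetricSpace.

Theorem proposition3p8 (R : realType) (X : metricType R) (n : nat)
    (T : X -> X) :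
  `I_2 #<= [set: X] ->
  (2 <= n)%N ->
  `I_n #<= [set: X] ->
  kannan_type n T ->
  forall p : X, T p = p -> {for p, continuous T}.
Proof.
Import Order.TTheory GRing.Theory Num.Theory.
Local Open Scope ring_scope.
move=> _; case: n => [|[|k]]// _ _ [l [/andP[l0 ln] kT]] p Tp.
have l1 : 0 < 1 - l.
  rewrite subr_gt0 (lt_trans ln)// ltr_pdivrMr ?ltr0n// mul1r.
  by rewrite ltrBlDr ltrDl.
rewrite /prop_for /continuous_at Tp.
apply/metricType_numDomainType.cvgrPdist_le => e e0.
apply/metricType_numDomainType.nbhs_mdistP.
have [[d d0 pd]|Np] := pselect (isolated_point p).
  by exists d => //= y /= /pd ->; rewrite Tp mdistxx ltW.
(* Here n is [k.+2], so [p] is accompanied by [k.+1] points: [x] and [k] new ones. If all are within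
   [d] of [p], their distances to [p] add up to at most [(1 - l) * e]. *)
pose d := (1 - l) * e / k.+1%:R.
have d0 : 0 < d by rewrite divr_gt0 ?mulr_gt0.
exists d => //= x /= xd.
have [->|xp] := eqVneq x p; first by rewrite Tp mdistxx ltW.
have ux : uniq [:: p; x] by rewrite /= in_cons orbF eq_sym xp.
have xs : {in [:: x], forall y, mdist p y < d} by move=> y; rewrite inE => /eqP->.
have [t [ut st td]] := non_isolated_extend k Np d0 ux xs.
have szt : size (t ++ [:: x]) = k.+1 by rewrite size_cat st addn1.
have bound := kannan_fixed_point_bound l0 kT Tp ut szt.
rewrite -(ler_pM2l l1).
(* The distance from [p] to [T x] is a single term of this sum of nonnegative terms. *)
apply: (@le_trans _ _ ((1 - l) * \sum_(y <- t ++ [:: x]) mdist p (T y))).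
  rewrite ler_pM2l// big_cat big_seq1 /= lerDr.
  by apply: sumr_ge0 => y _; apply: mdist_ge0.
apply: (le_trans bound).
have sum_ge0 : 0 <= \sum_(y <- t ++ [:: x]) mdist p y.
  by apply: sumr_ge0 => y _; apply: mdist_ge0.
(* The factor [l] is at most 1. *)
apply: (@le_trans _ _ (\sum_(y <- t ++ [:: x]) mdist p y)).
  by rewrite ler_piMl// ltW// -subr_gt0.
apply: (@le_trans _ _ (\sum_(y <- t ++ [:: x]) d)).
  by rewrite !big_seq; apply: ler_sum => y /td/ltW.
by rewrite big_const_seq count_predT szt iter_addr_0 -mulr_natr divfK ?pnatr_eq0.
Qed.
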